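(* Let $A\in\mathbb{R}^{m\times n}$ have nonzero rows $a_{1.},\dots,a_{m.}$ and columns $a_{.1},\dots,a_{.n}$, let $b\in\mathbb{R}^m$, and let $\hat{x}\in\mathbb{R}^n$, $\hat{\sigma}\in\mathbb{R}^m$ satisfy $A\hat{x}+\hat{\sigma}=b$, with $\hat{x}_j\in\mathbb{Z}$ for $j=q+1,\dots,n$. Suppose $(\hat{x},\hat{\sigma})>0$ componentwise, so that $\mathcal{I}=\{1,\dots,n\}$ and $\mathcal{I}_\sigma=\{1,\dots,m\}$, where $\mathcal{I}=\{i:\hat{x}_i>0\}$ and $\mathcal{I}_\sigma=\{i:\hat{\sigma}_i>0\}$. Then the optimization problem $[\mathrm{IOP2}(\hat{x},\hat{\sigma})]$ (defined in the context): (a) has optimal objective value $$\min\Big\{\min_{i\in\mathcal{I}}\hat{x}_i,\ \min_{i\in\mathcal{I}_\sigma}\frac{\hat{\sigma}_i}{\|a_{i.}\|_1}\Big\};$$ (b) whenever $\min_{i\in\mathcal{I}}\hat{x}_i\ge\min_{i\in\mathcal{I}_\sigma}\frac{\hat{\sigma}_i}{\|a_{i.}\|_1}$, has an optimal solution given by $$y^*=\frac{-e_p}{\|a_{p.}\|_1},\quad c^*=\frac{-a_{p.}}{\|a_{p.}\|_1},\quad s^*=0,\quad \varepsilon^*=0,\quad \varepsilon^{\sigma*}_p=\frac{\hat{\sigma}_p}{\|a_{p.}\|_1},\quad \varepsilon^{\sigma*}_i=0\ \text{ for } i\in\mathcal{I}_\sigma\setminus\{p\},$$ where $p\in\arg\min_{i\in\mathcal{I}_\sigma}\frac{\hat{\sigma}_i}{\|a_{i.}\|_1}$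 and $e_p\in\mathbb{R}^m$ is the $p$th unit vector; (c) whenever $\min_{i\in\mathcal{I}}\hat{x}_i\le\min_{i\in\mathcal{I}_\sigma}\frac{\hat{\sigma}_i}{\|a_{i.}\|_1}$, has an optimal solution given by $$y^*=0,\quad c^*=e_p,\quad \varepsilon^{\sigma*}=0,\quad \varepsilon^*_p=\hat{x}_p,\quad \varepsilon^*_i=0\ \text{ for } i\in\mathcal{I}\setminus\{p\},$$ where $p\in\arg\min_{i\in\mathcal{I}}\hat{x}_i$ and $e_p\in\mathbb{R}^n$ is the $p$th unit vector.
   Context: The forward problem has inequality constraints $Ax\le b$, $x\ge 0$ ($x_j$ integer for $j=q+1,\dots,n$, with $q\in\{0,\dots,n\}$ fixed), written with slacks as $\min\{c^\top x: Ax+\sigma=b,\ x,\sigma\ge 0\}$, where the slacks are required to have zero cost. For a given feasible $(\hat{x},\hat{\sigma})$ put $\mathcal{I}=\{i\in\{1,\dots,n\}:\hat{x}_i>0\}$, $\bar{\mathcal{I}}=\{i\in\{1,\dots,n\}:\hat{x}_i=0\}$, $\mathcal{I}_\sigma=\{i\in\{1,\dots,m\}:\hat{\sigma}_i>0\}$, $\bar{\mathcal{I}}_\sigma=\{i\in\{1,\dots,m\}:\hat{\sigma}_i=0\}$. The problem $[\mathrm{IOP2}(\hat{x},\hat{\sigma})]$, in the variables $c\in\mathbb{R}^n$, $y\in\mathbb{R}^m$, $\varepsilon=(\varepsilon_i)_{i\in\mathcal{I}}$, $\varepsilon^\sigma=(\varepsilon^\sigma_i)_{i\in\mathcal{I}_\sigma}$,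 $s=(s_i)_{i\in\bar{\mathcal{I}}}$, $\sigma=(\sigma_i)_{i\in\bar{\mathcal{I}}_\sigma}$, is $$\begin{aligned} \min\ & \sum_{i\in\mathcal{I}}\varepsilon_i+\sum_{i\in\mathcal{I}_\sigma}\varepsilon^\sigma_i\\ \text{s.t. } & a_{.i}^\top y+\frac{\varepsilon_i}{\hat{x}_i}-c_i=0, && i\in\mathcal{I},\\ & a_{.i}^\top y+s_i-c_i=0, && i\in\bar{\mathcal{I}},\\ & y_i+\frac{\varepsilon^\sigma_i}{\hat{\sigma}_i}=0, && i\in\mathcal{I}_\sigma,\\ & y_i+\sigma_i=0, && i\in\bar{\mathcal{I}}_\sigma,\\ & \|c\|_1=1, &&\\ & \varepsilon_i\ge 0,\ i\in\mathcal{I};\quad \varepsilon^\sigma_i\ge 0,\ i\in\mathcal{I}_\sigma;\quad s_i\ge 0,\ i\in\bar{\mathcal{I}};\quad \sigma_i\ge 0,\ i\in\bar{\mathcal{I}}_\sigma. && \end{aligned}$$ When $(\hat{x},\hat{\sigma})>0$, the sets $\bar{\mathcal{I}}$ and $\bar{\mathcal{I}}_\sigma$ are empty, so the variables $s$ and $\sigma$ and their constraints are absent (the assertion $s^*=0$ is then vacuous). $\|\cdot\|_1$ is the $\ell_1$ norm; a row $a_{i.}$ is identified with a vector in $\mathbb{R}^n$. *)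

(* Defs.v *)
From HB Require Import structures.
From mathcomp Require Import all_boot all_order all_algebra.
From mathcomp Require Import all_classical.
From mathcomp Require Import reals constructive_ereal ereal.

Set Implicit Arguments.
Unset Strict Implicit.
Unset Printing Implicit Defensive.

Import Order.TTheory GRing.Theory Num.Theory.

Local Open Scope classical_set_scope.
Local Open Scope ring_scope.

Definition l1norm (R : realType) (k : nat) (v : 'cV[R]_k) : R :=
  \sum_(i < k) `|v i 0|.

Definition rowvec (R : realType) (m n : nat) (A : 'M[R]_(m, n)) (i : 'I_m) :
  'cV[R]_n := (row i A)^T.

Definition colvec (R : realType) (m n : nat) (A : 'M[R]_(m, n)) (j : 'I_n) :
  'cV[R]_m := col j A.

Definition dotv (R : realType) (k : nat) (u v : 'cV[R]_k) : R :=
  \sum_(i < k) u i 0 * v i 0.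

Definition pos_set (R : realType) (k : nat) (v : 'cV[R]_k) : {set 'I_k} :=
  [set i | 0 < v i 0]%SET.

Definition zero_set (R : realType) (k : nat) (v : 'cV[R]_k) : {set 'I_k} :=
  [set i | v i 0 == 0]%SET.

(* The families eps, epss, s, sigma are indexed exactly by the positive and
   zero components of xh and sh, so s and sigma are empty families when xh and
   sh are positive. *)
Record IOP2_point (R : realType) (m n : nat)
    (xh : 'cV[R]_n) (sh : 'cV[R]_m) : Type := IOP2Point {
  pt_c : 'cV[R]_n ;
  pt_y : 'cV[R]_m ;
  pt_eps : {ffun {i : 'I_n | i \in pos_set xh} -> R} ;
  pt_epss : {ffun {i : 'I_m | i \in pos_set sh} -> R} ;
  pt_s : {ffun {i : 'I_n | i \in zero_set xh} -> R} ;
  pt_sigma : {ffun {i : 'I_m | i \in zero_set sh} -> R} }.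

Definition IOP2_objective (R : realType) (m n : nat)
    (xh : 'cV[R]_n) (sh : 'cV[R]_m) (z : IOP2_point xh sh) : R :=
  \sum_i pt_eps z i + \sum_i pt_epss z i.

Record IOP2_feasible (R : realType) (m n : nat) (A : 'M[R]_(m, n))
    (xh : 'cV[R]_n) (sh : 'cV[R]_m) (z : IOP2_point xh sh) : Prop := {
  feas_eps : forall i : {i : 'I_n | i \in pos_set xh},
    dotv (colvec A (val i)) (pt_y z) + pt_eps z i / xh (val i) 0
      - pt_c z (val i) 0 = 0 ;
  feas_s : forall i : {i : 'I_n | i \in zero_set xh},
    dotv (colvec A (val i)) (pt_y z) + pt_s z i - pt_c z (val i) 0 = 0 ;
  feas_epss : forall i : {i : 'I_m | i \in pos_set sh},
    pt_y z (val i) 0 + pt_epss z i / sh (val i) 0 = 0 ;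
  feas_sigma : forall i : {i : 'I_m | i \in zero_set sh},
    pt_y z (val i) 0 + pt_sigma z i = 0 ;
  feas_norm : l1norm (pt_c z) = 1 ;
  feas_eps_ge0 : forall i, 0 <= pt_eps z i ;
  feas_epss_ge0 : forall i, 0 <= pt_epss z i ;
  feas_s_ge0 : forall i, 0 <= pt_s z i ;
  feas_sigma_ge0 : forall i, 0 <= pt_sigma z i }.

Definition IOP2_optimal (R : realType) (m n : nat) (A : 'M[R]_(m, n))
    (xh : 'cV[R]_n) (sh : 'cV[R]_m) (z : IOP2_point xh sh) : Prop :=
  IOP2_feasible A z /\
  forall z' : IOP2_point xh sh,
    IOP2_feasible A z' -> IOP2_objective z <= IOP2_objective z'.

(* Extended-real convention: the value of an infeasible problem is +oo.
   A finite optimal value is required to be attained (min, not just inf). *)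
Definition IOP2_has_optimal_value (R : realType) (m n : nat)
    (A : 'M[R]_(m, n)) (xh : 'cV[R]_n) (sh : 'cV[R]_m) (v : \bar R) : Prop :=
  ereal_inf [set (IOP2_objective z)%:E |
             z in [set z : IOP2_point xh sh | IOP2_feasible A z]] = v /\
  (v \is a fin_num ->
   exists z : IOP2_point xh sh,
     IOP2_optimal A z /\ (IOP2_objective z)%:E = v).

(* The minimum over the empty set is +oo. *)
Definition min_over (R : realType) (k : nat) (S : {set 'I_k}) (f : 'I_k -> R) :
  \bar R := \big[mine/+oo%E]_(i in S) (f i)%:E.

Definition is_argmin (R : realType) (k : nat) (S : {set 'I_k}) (f : 'I_k -> R)
    (p : 'I_k) : Prop :=
  p \in S /\ forall i, i \in S -> f p <= f i.

(* Main.v *)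
Require Import Defs.
From HB Require Import structures.
From mathcomp Require Import all_boot all_order all_algebra.
From mathcomp Require Import all_classical.
From mathcomp Require Import reals constructive_ereal ereal.

(** Since the incumbent is strictly positive, every [eps] and [epss] is
    determined by [c] and [y]: the reduced costs [c_j - a_.j^T y] and the
    multipliers [- y_i] are nonnegative, and the objective is their sum
    weighted by [xh_j] and [sh_i] ([objective_reduced_costs]).  The
    normalisation forces these quantities not to be small all together:
    decomposing [c = (c - A^T y) + A^T y] and applying the triangle inequality
    gives [1 = |c|_1 <= sum_j (c_j - a_.j^T y) + sum_i |a_i.|_1 (- y_i)]
    ([l1norm_reduced_cost_bound]).  In this inequality the objective pays
    [xh_j] per unit of a reduced cost, and [sh_i / |a_i.|_1] per unit of a
    term [|a_i.|_1 (- y_i)], so it is at least the smallest of these prices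
    ([objective_lower_bound]).

    The bound is attained by putting all the weight on a cheapest term: a
    single reduced cost ([column_point]) or a single multiplier
    ([row_point]).  If there is no variable at all, nothing is feasible and
    both minima are infinite: a row of length zero cannot be nonzero, so there
    is no constraint either. *)

Set Implicit Arguments.
Unset Strict Implicit.
Unset Printing Implicit Defensive.

Import Order.TTheory GRing.Theory Num.Theory.

Local Open Scope ring_scope.

(** * The l1 norm and minima over index sets *)

Lemma l1norm_ge0 (R : realType) k (v : 'cV[R]_k) : 0 <= l1norm v.
Proof. by apply: sumr_ge0 => i _; exact: normr_ge0. Qed.

Lemma l1norm_gt0 (R : realType) k (v : 'cV[R]_k) : v != 0 -> 0 < l1norm v.
Proof.
move=> v_neq0; rewrite lt_neqAle l1norm_ge0 andbT eq_sym.
apply: contra v_neq0 => /eqP norm0; apply/eqP/colP => i; rewrite mxE.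
by apply: normr0_eq0; rewrite (psumr_eq0P (fun i _ => normr_ge0 (v i 0)) norm0).
Qed.

Lemma l1normZ (R : realType) k (a : R) (v : 'cV[R]_k) :
  l1norm (a *: v) = `|a| * l1norm v.
Proof. by rewrite /l1norm mulr_sumr; apply: eq_bigr => i _; rewrite mxE normrM. Qed.

Lemma l1norm_delta (R : realType) k (p : 'I_k) :
  l1norm (delta_mx p 0 : 'cV[R]_k) = 1.
Proof.
rewrite /l1norm (bigD1 p) //= big1 ?addr0 => [|i /negPf ip].
  by rewrite mxE !eqxx normr1.
by rewrite mxE ip normr0.
Qed.

Lemma min_over_argmin (R : realType) k (S : {set 'I_k}) (f : 'I_k -> R) p :
  is_argmin S f p -> min_over S f = (f p)%:E.
Proof.
move=> [pS fp]; apply/le_anti/andP; split.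
  exact: (bigmin_le_cond _ (fun i => (f i)%:E)).
by apply: le_bigmin => [|i iS]; rewrite ?leey // lee_fin fp.
Qed.

Lemma exists_argmin (R : realType) k (S : {set 'I_k}) (f : 'I_k -> R) i :
  i \in S -> exists p, is_argmin S f p.
Proof. by move=> iS; case: (arg_minP f iS) => p pS fp; exists p. Qed.

Lemma sum_pos_set (R : realType) k (v : 'cV[R]_k) (F : 'I_k -> R) :
  (forall i, 0 < v i 0) ->
  \sum_(i : {i : 'I_k | i \in pos_set v}) F (val i) = \sum_i F i.
Proof.
move=> v_gt0; rewrite -(big_sub (mem (pos_set v)) F).
by apply: eq_bigl => i; rewrite /= inE v_gt0.
Qed.

(** Discharges the conditions on [pt_s] and [pt_sigma], whose index types are
    empty for a positive incumbent. *)
Lemma zero_set_elim (R : realType) k (v : 'cV[R]_k) (P : Prop) :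
  (forall i, 0 < v i 0) -> {i : 'I_k | i \in zero_set v} -> P.
Proof. by move=> v_gt0 [i]; rewrite inE gt_eqF. Qed.

(** * The lower bound *)

(** Triangle inequality for [c = (c - A^T y) + A^T y], the sign conditions
    making the absolute values of the reduced costs and of [y] explicit. *)
Lemma l1norm_reduced_cost_bound (R : realType) m n (A : 'M[R]_(m, n))
    (c : 'cV[R]_n) (y : 'cV[R]_m) :
  (forall j, 0 <= c j 0 - dotv (colvec A j) y) -> (forall i, y i 0 <= 0) ->
  l1norm c <= \sum_j (c j 0 - dotv (colvec A j) y)
              + \sum_i l1norm (rowvec A i) * - y i 0.
Proof.
move=> red_ge0 y_le0.
have -> : \sum_i l1norm (rowvec A i) * - y i 0
          = \sum_j \sum_i `|A i j| * - y i 0.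
  rewrite exchange_big; apply: eq_bigr => i _; rewrite /l1norm mulr_suml.
  by apply: eq_bigr => j _; rewrite !mxE.
rewrite -big_split; apply: ler_sum => j _ /=.
rewrite -{1}[c j 0](subrK (dotv (colvec A j) y)).
apply: (le_trans (ler_normD _ _)); rewrite ger0_norm // lerD2l.
apply: (le_trans (ler_norm_sum _ _ _)); apply: ler_sum => i _.
by rewrite mxE normrM (ler0_norm (y_le0 i)).
Qed.

Lemma feasible_reduced_cost (R : realType) m n (A : 'M[R]_(m, n))
    (xh : 'cV[R]_n) (sh : 'cV[R]_m) (z : IOP2_point xh sh) i :
  IOP2_feasible A z ->
  pt_eps z i
  = xh (val i) 0 * (pt_c z (val i) 0 - dotv (colvec A (val i)) (pt_y z)).
Proof.
move=> /feas_eps/(_ i)/subr0_eq <-.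
have : 0 < xh (val i) 0 by have := valP i; rewrite inE.
by move=> /lt0r_neq0 x_neq0; rewrite addrC addKr mulrC divfK.
Qed.

Lemma feasible_multiplier (R : realType) m n (A : 'M[R]_(m, n))
    (xh : 'cV[R]_n) (sh : 'cV[R]_m) (z : IOP2_point xh sh) i :
  IOP2_feasible A z -> pt_epss z i = sh (val i) 0 * - pt_y z (val i) 0.
Proof.
move=> /feas_epss/(_ i)/eqP; rewrite addrC addr_eq0 => /eqP <-.
have : 0 < sh (val i) 0 by have := valP i; rewrite inE.
by move=> /lt0r_neq0 s_neq0; rewrite mulrC divfK.
Qed.

Lemma objective_reduced_costs (R : realType) m n (A : 'M[R]_(m, n))
    (xh : 'cV[R]_n) (sh : 'cV[R]_m) (z : IOP2_point xh sh) :
  (forall j, 0 < xh j 0) -> (forall i, 0 < sh i 0) -> IOP2_feasible A z ->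
  IOP2_objective z
  = \sum_j xh j 0 * (pt_c z j 0 - dotv (colvec A j) (pt_y z))
    + \sum_i sh i 0 * - pt_y z i 0.
Proof.
move=> hx hs feas; rewrite -(sum_pos_set _ hx) -(sum_pos_set _ hs).
congr (_ + _); apply: eq_bigr => i _; first exact: feasible_reduced_cost.
exact: (feasible_multiplier i feas).
Qed.

(** Scale [l1norm_reduced_cost_bound] by [v], with [l1norm c = 1], and compare
    with the objective term by term.  The condition [v <= sh_i / |a_i.|_1]
    appears without the division, the form in which the comparison uses it. *)
Lemma objective_lower_bound (R : realType) m n (A : 'M[R]_(m, n))
    (xh : 'cV[R]_n) (sh : 'cV[R]_m) (v : R) (z : IOP2_point xh sh) :
  (forall j, 0 < xh j 0) -> (forall i, 0 < sh i 0) ->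
  0 <= v -> (forall j, v <= xh j 0) ->
  (forall i, v * l1norm (rowvec A i) <= sh i 0) ->
  IOP2_feasible A z -> v <= IOP2_objective z.
Proof.
move=> hx hs v_ge0 vx vs feas.
have red_ge0 j : 0 <= pt_c z j 0 - dotv (colvec A j) (pt_y z).
  have jI : j \in pos_set xh by rewrite inE.
  have := feas_eps_ge0 feas (exist _ j jI).
  by rewrite (feasible_reduced_cost _ feas) pmulr_rge0 ?hx.
have y_ge0 i : 0 <= - pt_y z i 0.
  have iI : i \in pos_set sh by rewrite inE.
  have := feas_epss_ge0 feas (exist _ i iI).
  by rewrite (feasible_multiplier _ feas) pmulr_rge0 ?hs.
have y_le0 i : pt_y z i 0 <= 0 by rewrite -oppr_ge0.
have := l1norm_reduced_cost_bound red_ge0 y_le0.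
rewrite (feas_norm feas) => /(ler_wpM2l v_ge0); rewrite mulr1 => /le_trans; apply.
rewrite (objective_reduced_costs hx hs feas) mulrDr !mulr_sumr.
apply: lerD; apply: ler_sum => i _; first exact: ler_wpM2r.
by rewrite mulrA ler_wpM2r.
Qed.

(** * The candidate minimizers *)

(** The cost vector is the inward normal of the [p]-th constraint, scaled to
    norm one; the multiplier [y] makes all reduced costs vanish, so that only
    the slack of that constraint is paid for. *)
Definition row_point (R : realType) m n (A : 'M[R]_(m, n))
    (xh : 'cV[R]_n) (sh : 'cV[R]_m) (p : 'I_m) : IOP2_point xh sh :=
  @IOP2Point R m n xh sh
    (- (l1norm (rowvec A p))^-1 *: rowvec A p)
    (- (l1norm (rowvec A p))^-1 *: delta_mx p 0)
    [ffun=> 0]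
    [ffun i => if val i == p then sh p 0 / l1norm (rowvec A p) else 0]
    [ffun=> 0]
    [ffun=> 0].

(** With [y = 0] the reduced costs are the costs themselves, and [e_p] is the
    cost vector that charges only the [p]-th variable. *)
Definition column_point (R : realType) m n (xh : 'cV[R]_n) (sh : 'cV[R]_m)
    (p : 'I_n) : IOP2_point xh sh :=
  @IOP2Point R m n xh sh
    (delta_mx p 0)
    0
    [ffun i => if val i == p then xh p 0 else 0]
    [ffun=> 0]
    [ffun=> 0]
    [ffun=> 0].

Lemma dotvZ_delta (R : realType) k (u : 'cV[R]_k) (a : R) (p : 'I_k) :
  dotv u (a *: delta_mx p 0) = a * u p 0.
Proof.
rewrite /dotv (bigD1 p) //= big1 ?addr0 => [|i /negPf ip].
  by rewrite !mxE !eqxx mulr1 mulrC.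
by rewrite !mxE ip !mulr0.
Qed.

Lemma dotv0 (R : realType) k (u : 'cV[R]_k) : dotv u 0 = 0.
Proof. by rewrite /dotv big1 // => i _; rewrite mxE mulr0. Qed.

Lemma row_point_feasible (R : realType) m n (A : 'M[R]_(m, n))
    (xh : 'cV[R]_n) (sh : 'cV[R]_m) (p : 'I_m) :
  (forall j, 0 < xh j 0) -> (forall i, 0 < sh i 0) -> rowvec A p != 0 ->
  IOP2_feasible A (row_point A xh sh p).
Proof.
move=> hx hs /l1norm_gt0 norm_gt0; split=> /=.
- by move=> i; rewrite ffunE mul0r addr0 dotvZ_delta !mxE subrr.
- by move=> i; apply: (zero_set_elim _ hx i).
- move=> i; rewrite ffunE !mxE eqxx andbT.
  case: eqP => [->|_]; last by rewrite mulr0 mul0r addr0.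
  by rewrite mulr1 mulrAC divff ?mul1r ?addNr // gt_eqF.
- by move=> i; apply: (zero_set_elim _ hs i).
- by rewrite l1normZ normrN gtr0_norm ?invr_gt0 // mulVf // gt_eqF.
- by move=> i; rewrite ffunE.
- by move=> i; rewrite ffunE; case: ifP => // _; rewrite divr_ge0 ?ltW.
- by move=> i; rewrite ffunE.
- by move=> i; rewrite ffunE.
Qed.

Lemma column_point_feasible (R : realType) m n (A : 'M[R]_(m, n))
    (xh : 'cV[R]_n) (sh : 'cV[R]_m) (p : 'I_n) :
  (forall j, 0 < xh j 0) -> (forall i, 0 < sh i 0) ->
  IOP2_feasible A (column_point xh sh p).
Proof.
move=> hx hs; split=> /=.
- move=> i; rewrite ffunE dotv0 add0r mxE eqxx andbT.
  case: eqP => [->|_]; last by rewrite mul0r subrr.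
  by rewrite divff ?subrr // gt_eqF.
- by move=> i; apply: (zero_set_elim _ hx i).
- by move=> i; rewrite ffunE mxE mul0r addr0.
- by move=> i; apply: (zero_set_elim _ hs i).
- exact: l1norm_delta.
- by move=> i; rewrite ffunE; case: ifP => // _; rewrite ltW.
- by move=> i; rewrite ffunE.
- by move=> i; rewrite ffunE.
- by move=> i; rewrite ffunE.
Qed.

Lemma row_point_objective (R : realType) m n (A : 'M[R]_(m, n))
    (xh : 'cV[R]_n) (sh : 'cV[R]_m) (p : 'I_m) :
  (forall i, 0 < sh i 0) ->
  IOP2_objective (row_point A xh sh p) = sh p 0 / l1norm (rowvec A p).
Proof.
move=> hs; rewrite /IOP2_objective /= big1 ?add0r => [|i _]; last by rewrite ffunE.
under eq_bigr do rewrite ffunE.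
rewrite (sum_pos_set (fun i => if i == p then _ else 0) hs).
by rewrite -big_mkcond big_pred1_eq.
Qed.

Lemma column_point_objective (R : realType) m n
    (xh : 'cV[R]_n) (sh : 'cV[R]_m) (p : 'I_n) :
  (forall j, 0 < xh j 0) ->
  IOP2_objective (column_point xh sh p) = xh p 0.
Proof.
move=> hx; rewrite /IOP2_objective /= addrC big1 ?add0r => [|i _]; last by rewrite ffunE.
under eq_bigr do rewrite ffunE.
rewrite (sum_pos_set (fun i => if i == p then _ else 0) hx).
by rewrite -big_mkcond big_pred1_eq.
Qed.

(** * Optimality *)

(** Both minima are compared in the extended reals, where the minimum over
    no rows is [+oo]: without constraints, the second inequality is no
    restriction. *)
Lemma optimal_of_minima (R : realType) m n (A : 'M[R]_(m, n))
    (xh : 'cV[R]_n) (sh : 'cV[R]_m) (z : IOP2_point xh sh) :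
  (forall j, 0 < xh j 0) -> (forall i, 0 < sh i 0) ->
  (forall i, rowvec A i != 0) ->
  IOP2_feasible A z ->
  ((IOP2_objective z)%:E <= min_over (pos_set xh) (fun j => xh j 0%R))%E ->
  ((IOP2_objective z)%:E
     <= min_over (pos_set sh) (fun i => sh i 0%R / l1norm (rowvec A i))%R)%E ->
  IOP2_optimal A z.
Proof.
move=> hx hs hrows feas le_minx le_mins; split=> // z'.
apply: objective_lower_bound => //.
- by rewrite addr_ge0 ?sumr_ge0 // => i _;
    [exact: (feas_eps_ge0 feas)|exact: (feas_epss_ge0 feas)].
- move=> j; rewrite -lee_fin; apply: (le_trans le_minx).
  by apply: (bigmin_le_cond _ (fun j => (xh j 0)%:E)); rewrite inE.
- move=> i; rewrite -ler_pdivlMr ?l1norm_gt0 // -lee_fin.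
  apply: (le_trans le_mins).
  by apply: (bigmin_le_cond _ (fun i => (sh i 0 / l1norm (rowvec A i))%:E));
    rewrite inE.
Qed.

Lemma has_optimal_value_of_optimal (R : realType) m n (A : 'M[R]_(m, n))
    (xh : 'cV[R]_n) (sh : 'cV[R]_m) (z : IOP2_point xh sh) :
  IOP2_optimal A z -> IOP2_has_optimal_value A xh sh (IOP2_objective z)%:E.
Proof.
move=> opt; split; last by exists z.
apply/le_anti/andP; split.
  by apply: ereal_inf_lbound; exists z => //; case: opt.
by apply: le_ereal_inf_tmp => _ [z' feas <-]; rewrite lee_fin; apply: (proj2 opt).
Qed.

(** Infeasibility: the only cost vector is empty and has norm [0], not [1]. *)
Lemma has_optimal_value_no_variable (R : realType) m n (A : 'M[R]_(m, n))
    (xh : 'cV[R]_n) (sh : 'cV[R]_m) :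
  n = 0%N -> IOP2_has_optimal_value A xh sh +oo%E.
Proof.
move=> n0; split=> //; rewrite -[RHS](ereal_inf0 R); congr ereal_inf.
apply/seteqP; split=> // v [z feas _]; have := feas_norm feas.
rewrite /l1norm big1 => [/esym/eqP|[i lt_in] _]; first by rewrite oner_eq0.
by exfalso; rewrite n0 in lt_in.
Qed.

Theorem proposition3 (R : realType) (m n q : nat) (A : 'M[R]_(m, n))
    (b : 'cV[R]_m) (xh : 'cV[R]_n) (sh : 'cV[R]_m)
    (hq : (q <= n)%N)
    (hrows : forall i : 'I_m, rowvec A i != 0)
    (hfeas : A *m xh + sh = b)
    (* 0-based indices: the integer components j = q+1, ..., n *)
    (hint : forall j : 'I_n, (q <= j)%N -> xh j 0 \is a Num.int)
    (hx : forall j : 'I_n, 0 < xh j 0)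
    (hs : forall i : 'I_m, 0 < sh i 0) :
  let I := pos_set xh in
  let Is := pos_set sh in
  let ratio := fun i : 'I_m => sh i 0 / l1norm (rowvec A i) in
  let minx := min_over I (fun i => xh i 0) in
  let mins := min_over Is ratio in
  IOP2_has_optimal_value A xh sh (mine minx mins)
  /\
  ((mins <= minx)%E ->
   forall p : 'I_m, is_argmin Is ratio p ->
   IOP2_optimal A
     (@IOP2Point R m n xh sh
        (* c *)     (- (l1norm (rowvec A p))^-1 *: rowvec A p)
        (* y *)     (- (l1norm (rowvec A p))^-1 *: delta_mx p 0)
        (* eps *)   [ffun=> 0]
        (* epss *)  [ffun i => if val i == p then ratio p else 0]
        (* s *)     [ffun=> 0]
        (* sigma *) [ffun=> 0]))
  /\
  ((minx <= mins)%E ->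
   forall p : 'I_n, is_argmin I (fun i => xh i 0) p ->
   IOP2_optimal A
     (@IOP2Point R m n xh sh
        (* c *)     (delta_mx p 0)
        (* y *)     0
        (* eps *)   [ffun i => if val i == p then xh p 0 else 0]
        (* epss *)  [ffun=> 0]
        (* s *)     [ffun=> 0]
        (* sigma *) [ffun=> 0])).
Proof.
move=> I Is ratio minx mins.
have row_optimal p : (mins <= minx)%E -> is_argmin Is ratio p ->
    IOP2_optimal A (row_point A xh sh p).
  move=> le_min /min_over_argmin mins_p.
  by apply: optimal_of_minima; rewrite ?row_point_objective //;
    [exact: row_point_feasible | rewrite -[X in (X <= _)%E]mins_p ..].
have column_optimal p : (minx <= mins)%E -> is_argmin I (fun j => xh j 0) p ->
    IOP2_optimal A (column_point xh sh p).
  move=> le_min /min_over_argmin minx_p.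
  by apply: optimal_of_minima; rewrite ?column_point_objective //;
    [exact: column_point_feasible | rewrite -[X in (X <= _)%E]minx_p ..].
split; last by split=> [le_min p|le_min p]; [exact: row_optimal|exact: column_optimal].
case: (posnP n) => [n0|n_gt0].
  have no_col (j : 'I_n) : False by case: j => j; rewrite n0.
  have no_row (i : 'I_m) : False.
    by move/eqP: (hrows i); apply; apply/colP => j; case: (no_col j).
  have -> : minx = +oo%E by rewrite /minx /min_over big1 // => j; case: (no_col j).
  have -> : mins = +oo%E by rewrite /mins /min_over big1 // => i; case: (no_row i).
  by rewrite minxx; apply: has_optimal_value_no_variable.
case: (leP minx mins) => [le_min|lt_min].
  have [|p argp] := @exists_argmin _ _ I (fun j => xh j 0) (Ordinal n_gt0).
    by rewrite inE.
  have -> : minx = (xh p 0)%:E by exact: min_over_argmin.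
  rewrite -(column_point_objective sh p hx).
  by apply: has_optimal_value_of_optimal; apply: column_optimal.
(* A minimum strictly below another one is finite, so there is a row. *)
case: (set_0Vmem Is) => [Is0|[i iIs]].
  by move: lt_min; rewrite /mins /min_over Is0 big_set0 ltNge leey.
have [p argp] := exists_argmin ratio iIs.
have -> : mins = (ratio p)%:E by exact: min_over_argmin.
rewrite -[ratio p](row_point_objective A xh p hs).
by apply: has_optimal_value_of_optimal; apply: row_optimal (ltW lt_min) argp.
Qed.
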